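(* For each positive integer $k$ and real $x$, let $$f_k(x) = \lfloor kx \rfloor - \sum_{j=1}^k \frac1j \lfloor jx \rfloor,$$ and for each integer $n \geq 1$ let $S_n = \{ f_k(x) : x \in \mathbb{R},\ k \text{ an integer with } k \geq n \}$. Then for every integer $n \geq 1$, the set $S_n$ is dense in $[1-\log 2, +\infty)$.
   Context: $\lfloor t \rfloor$ denotes the greatest integer less than or equal to $t$, and $\log$ is the natural logarithm. A set $S \subseteq \mathbb{R}$ (not necessarily contained in the interval $I$) is called dense in an interval $I$ if $S \cap I$ is a dense subset of $I$. *)

(* Defs.v *)
From mathcomp Require Import all_boot all_order all_algebra.
From mathcomp Require Import all_classical all_reals all_analysis.
Set Implicit Arguments.
Unset Strict Implicit.
Unset Printing Implicit Defensive.
Import Order.TTheory GRing.Theory Num.Theory.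
Import numFieldNormedType.Exports.
Local Open Scope classical_set_scope.
Local Open Scope ring_scope.

Definition f (R : realType) (k : nat) (x : R) : R :=
  (Num.floor (k%:R * x))%:~R
  - \sum_(1 <= j < k.+1) j%:R^-1 * (Num.floor (j%:R * x))%:~R.

Definition S_ (R : realType) (n : nat) : set R :=
  [set y | exists (k : nat) (x : R), (n <= k)%N /\ y = f k x].

Arguments S_ R n : clear implicits.

(* [S] need not be contained in [I]. The type [subspace I] makes the points
   outside [I] isolated, so the library's [dense] on it would force [S] to
   contain the complement of [I]; hence the closure in the ambient space. *)
Definition dense_in (T : topologicalType) (S I : set T) : Prop :=
  I `<=` closure (S `&` I).

(* Main.v *)
Require Import Defs.
From mathcomp Require Import all_boot all_order all_algebra.
From mathcomp Require Import all_classical all_reals all_analysis.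
From mathcomp Require Import ring lra.
Import Order.TTheory GRing.Theory Num.Theory.
Import numFieldNormedType.Exports.
Local Open Scope classical_set_scope.
Local Open Scope ring_scope.

(** The points [x = 1/a], with [a] a large integer, already suffice.  Writing
    [jx = floor (jx) + {jx}] gives [f_k(x) = sum_(j <= k) {jx}/j - {kx}], and
    for [x = 1/a] the fractional part [{j/a}] is [(j mod a)/a].  Put
    [s(K) = sum_(j < K) (j mod a)/(a j)] ([frac_sum]); as [K] grows, [s(K)]
    is nondecreasing.

    While [k] runs over the block [N a <= k < (N+1) a], the subtracted term
    [{k/a}] climbs from [0] to [1 - 1/a] by steps of [1/a].  Hence [f_k(1/a)]
    starts the block at [s(N a)], ends it at [s((N+1) a) - (1 - 1/a)], and
    never drops by more than [1/a] in one step ([f_inv_nat_step]).  By a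
    discrete intermediate value argument ([discrete_ivt]) the values in one
    block come within [1/a] above every real number between these two.

    These ranges cover [[1 - ln 2, +oo[].  The block [N = 1] ends at
    [1 - sum_(a <= j < 2a) 1/j], which is at most [1 - ln 2]
    ([first_block_end]).  Block [N] adds at most [1/(N+1)] to [s]
    ([frac_sum_block_le]), so two consecutive blocks with [N >= 1] add at most
    [1/2 + 1/3 <= 1 - 1/a] as soon as [a >= 6]: the range of each block reaches
    down to the start of the previous one.  Lastly [s(N a)] is unbounded, since block [N]
    adds at least [1/(a^2 (N+1))], a multiple of the harmonic series
    ([frac_sum_unbounded]). *)

(** * Comparison of harmonic sums with the logarithm *)

Lemma ln_le_harmonic (R : realType) (a b : nat) : (0 < a)%N -> (a <= b)%N ->
  ln (b%:R / a%:R : R) <= \sum_(a <= j < b) j%:R^-1.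
Proof.
move=> a0 ab; have b0 := leq_trans a0 ab.
rewrite ln_div ?posrE ?ltr0n//.
rewrite -(telescope_sumr (fun j => ln (j%:R : R)) ab).
rewrite !big_nat; apply: ler_sum => j /andP[aj _].
have j0 : (0 < j)%N := leq_trans a0 aj.
have j0R : 0 < j%:R :> R by rewrite ltr0n.
rewrite -ln_div ?posrE ?ltr0n//.
have -> : j.+1%:R / j%:R = 1 + j%:R^-1 :> R.
  by rewrite -natr1 mulrDl mul1r divff ?gt_eqF// addrC.
by apply: le_ln1Dx; rewrite (lt_trans _ (_ : 0 < _)) ?invr_gt0// ltrN10.
Qed.

Lemma harmonic_unbounded (R : realType) (M : R) :
  exists2 N : nat, (0 < N)%N & M <= \sum_(1 <= j < N.+1) j%:R^-1.
Proof.
exists (Num.bound (expR M)).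
  by rewrite -(ltr0n R) (lt_trans (expR_gt0 M))// unstable.ltr_bound.
set N := Num.bound _.
apply: le_trans (@ln_le_harmonic R 1 N.+1 _ _) => //.
rewrite divr1 -[leLHS]expRK ler_ln ?posrE ?expR_gt0 ?ltr0n//.
by rewrite ltW// (lt_le_trans (unstable.ltr_bound _))// ler_nat.
Qed.

(** * Values of [f] at the inverse of an integer *)

(** The bound on [j] is strict so that, for [K = N a], the sum consists of the
    first [N] full blocks; the next term, [j = N a], vanishes. *)
Definition frac_sum (R : realType) (a K : nat) : R :=
  \sum_(0 <= j < K) (j %% a)%:R / j%:R / a%:R.

Lemma floor_divn (R : realType) (a j : nat) : (0 < a)%N ->
  Num.floor (j%:R * a%:R^-1 : R) = (j %/ a)%N%:Z.
Proof.
move=> a0; have a0R : 0 < a%:R :> R by rewrite ltr0n.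
apply: floor_def.
rewrite ler_pdivlMr// ltr_pdivrMr// -PoszD -!pmulrn -!natrM ler_nat ltr_nat.
by rewrite leq_divM addn1 ltn_ceil.
Qed.

Lemma f_inv_nat (R : realType) (a k : nat) : (0 < a)%N ->
  f k (a%:R^-1 : R) = frac_sum R a k.+1 - (k %% a)%:R / a%:R.
Proof.
move=> a0; have aN0 : a%:R != 0 :> R by rewrite pnatr_eq0 -lt0n.
have divE j : (j %/ a)%:R = (j%:R - (j %% a)%:R) / a%:R :> R.
  by rewrite [in j%:R](divn_eq j a) natrD addrK natrM mulfK.
rewrite /f /frac_sum floor_divn// -pmulrn divE.
rewrite [in RHS]big_ltn// mod0n !mul0r add0r.
have -> : \sum_(1 <= j < k.+1) j%:R^-1 * (Num.floor (j%:R * a%:R^-1 : R))%:~R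
    = \sum_(1 <= j < k.+1) (a%:R^-1 - (j %% a)%:R / j%:R / a%:R) :> R.
  rewrite !big_nat; apply: eq_bigr => j /andP[j0 _].
  rewrite floor_divn// -pmulrn divE.
  have jN0 : j%:R != 0 :> R by rewrite pnatr_eq0 -lt0n.
  by field; rewrite aN0 jN0.
rewrite sumrB sumr_const_nat subn1 /= -mulr_natr.
by ring.
Qed.

(** Within a block only the fractional part of [k/a] makes [f] decrease, and
    it grows by [1/a] at a time. *)
Lemma f_inv_nat_step (R : realType) (a N r : nat) : (r.+1 < a)%N ->
  f (N * a + r) (a%:R^-1 : R) - a%:R^-1 <= f (N * a + r.+1) (a%:R^-1 : R).
Proof.
move=> ra; have a0 : (0 < a)%N by apply: leq_trans ra.
rewrite !f_inv_nat// !modnMDl modn_small 1?ltnW// modn_small//.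
rewrite addnS {2}/frac_sum big_nat_recr//= -/(frac_sum R a _).
set t := (X in _ <= _ + X - _); have t0 : 0 <= t by rewrite !mulr_ge0 ?invr_ge0.
rewrite -natr1 mulrDl mul1r.
lra.
Qed.

(** * Growth of [frac_sum] over one block *)

Lemma frac_sum_block (R : realType) (a N : nat) : (0 < a)%N ->
  frac_sum R a (N.+1 * a) =
  frac_sum R a (N * a) + \sum_(0 <= r < a) r%:R / (N * a + r)%:R / a%:R.
Proof.
move=> a0; rewrite /frac_sum (@big_cat_nat _ _ _ (N * a))//=; last first.
  by rewrite leq_pmul2r.
congr (_ + _); rewrite -{1}[(N * a)%N]add0n big_addn mulSn addnK.
rewrite !big_nat; apply: eq_bigr => r /andP[_ ra].
by rewrite addnC modnMDl modn_small.
Qed.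

(** A block consists of [a] terms, and [r/(N a + r) <= a/(N a + a)] because
    [r <= a]. *)
Lemma frac_sum_block_le (R : realType) (a N : nat) : (0 < a)%N ->
  frac_sum R a (N.+1 * a) <= frac_sum R a (N * a) + N.+1%:R^-1.
Proof.
move=> a0; have a0R : 0 < a%:R :> R by rewrite ltr0n.
rewrite frac_sum_block// lerD2l.
have -> : N.+1%:R^-1 = \sum_(0 <= r < a) N.+1%:R^-1 / a%:R :> R.
  by rewrite sumr_const_nat subn0 -[RHS]mulr_natr divfK// gt_eqF.
rewrite !big_nat; apply: ler_sum => r /andP[_ ra].
rewrite ler_pM2r ?invr_gt0//.
have [->|r0] := posnP r; first by rewrite mul0r.
rewrite ler_pdivrMr ?ltr0n ?addn_gt0 ?r0 ?orbT//.
rewrite mulrC ler_pdivlMr ?ltr0n// -natrM ler_nat.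
by rewrite mulnSr mulnC leq_add2r leq_mul2l ltnW ?orbT.
Qed.

(** The last term of a block alone, [r = a - 1], is at least
    [1/(a^2 (N+1))]. *)
Lemma frac_sum_block_ge (R : realType) (a N : nat) : (1 < a)%N ->
  frac_sum R a (N * a) + N.+1%:R^-1 / a%:R ^+ 2 <= frac_sum R a (N.+1 * a).
Proof.
move=> a1; have a0 := ltnW a1; have a0R : 0 < a%:R :> R by rewrite ltr0n.
rewrite frac_sum_block// lerD2l.
case: a a1 a0 a0R => // p p1 _ a0R.
rewrite big_nat_recr//= -[leLHS]add0r; apply: lerD.
  by apply: sumr_ge0 => r _; rewrite !mulr_ge0 ?invr_ge0.
rewrite expr2 invfM mulrA ler_pM2r ?invr_gt0//.
rewrite -invfM -natrM -div1r; apply: ler_pM => //.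
  by rewrite ler1n.
rewrite lef_pV2 ?posrE ?ltr0n ?addn_gt0 ?(p1 : (0 < p)%N) ?orbT//.
by rewrite ler_nat mulSn addnC leq_add2r leqnSn.
Qed.

Lemma frac_sum_unbounded (R : realType) (a : nat) (M : R) : (1 < a)%N ->
  exists2 N : nat, (0 < N)%N & M <= frac_sum R a (N * a).
Proof.
move=> a1; have a20 : 0 < a%:R ^+ 2 :> R by rewrite exprn_gt0// ltr0n ltnW.
have [N N0 hN] := harmonic_unbounded _ (M * a%:R ^+ 2); exists N => //.
rewrite -ler_pdivlMr// in hN; apply: le_trans hN _.
elim: N {N0} => [|N IHN]; first by rewrite big_geq// mul0r /frac_sum big_geq.
rewrite big_nat_recr//= mulrDl.
by apply: le_trans (frac_sum_block_ge _ _ _ a1); rewrite lerD2r.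
Qed.

(** The block [N = 0] contributes [1 - 1/a] to [frac_sum], and the block
    [N = 1] contributes the sum of [1/a - 1/(a+r)] for [r < a], that is
    [1 - sum_(a <= j < 2a) 1/j], where the last sum is at least [ln 2]. *)
Lemma first_block_end (R : realType) (a : nat) : (0 < a)%N ->
  frac_sum R a (2 * a) - (1 - a%:R^-1) <= 1 - ln 2.
Proof.
move=> a0; have aN0 : a%:R != 0 :> R by rewrite pnatr_eq0 -lt0n.
rewrite !frac_sum_block// mul0n mul1n [frac_sum _ _ _]big_geq// add0r.
have -> : \sum_(0 <= r < a) r%:R / (0 + r)%:R / a%:R = 1 - a%:R^-1 :> R.
  rewrite big_ltn// !mul0r add0r.
  rewrite (eq_big_nat _ _ (F2 := fun=> a%:R^-1)) => [|r /andP[r0 _]].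
    rewrite sumr_const_nat -[LHS]mulr_natr natrB// mulrBr mulr1 mulVf//.
  by rewrite add0n divff ?mul1r// pnatr_eq0 -lt0n.
have -> : \sum_(0 <= r < a) r%:R / (a + r)%:R / a%:R
    = 1 - \sum_(a <= j < 2 * a) j%:R^-1 :> R.
  have -> : \sum_(a <= j < 2 * a) j%:R^-1
      = \sum_(0 <= r < a) (a + r)%:R^-1 :> R.
    rewrite -{1}[a]add0n big_addn mul2n -addnn addnK.
    by apply: eq_bigr => r _; rewrite addnC.
  have sum1 : \sum_(0 <= r < a) a%:R^-1 = 1 :> R.
    by rewrite sumr_const_nat subn0 -[LHS]mulr_natr mulVf.
  rewrite -[X in _ = X - _]sum1 -sumrB; apply: eq_bigr => r _.
  have arN0 : (a + r)%:R != 0 :> R by rewrite pnatr_eq0 -lt0n addn_gt0 a0.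
  rewrite natrD in arN0 *; field.
  by rewrite aN0 arN0.
have := @ln_le_harmonic R a (2 * a) a0 (leq_pmull _ _).
rewrite natrM mulfK// => /(_ isT).
lra.
Qed.

(** * Covering the half-line *)

Lemma discrete_ivt (R : realDomainType) (u : nat -> R) (e y : R) (m : nat) :
  0 <= e -> (forall i, (i < m)%N -> u i - e <= u i.+1) ->
  y <= u 0%N -> u m <= y ->
  exists2 i, (i <= m)%N & y <= u i <= y + e.
Proof.
move=> e0; elim: m => [|m IHm] ue yu0 umy.
  by exists 0%N => //; rewrite yu0 (le_trans umy)// lerDl.
have [umy'|yum] := leP (u m) y.
  have [i im hi] := IHm (fun i im => ue i (ltnW im)) yu0 umy'.
  by exists i; rewrite // ltnW.
exists m => //; rewrite (ltW yum)/= -lerBlDr.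
exact: le_trans (ue m _) umy.
Qed.

(** The block that works is the first one, among [N >= 1], starting at
    [y] or above: either [N = 1], and it ends below [1 - ln 2], or the previous block
    starts below [y], and the two together raise [frac_sum] by at most
    [5/6 <= 1 - 1/a]; this is where [a >= 6] comes from. *)
Lemma f_inv_nat_approx (R : realType) (a : nat) (y : R) :
  (6 <= a)%N -> 1 - ln 2 <= y ->
  exists2 k : nat, (a <= k)%N & y <= f k (a%:R^-1 : R) <= y + a%:R^-1.
Proof.
move=> a6 hy; have a1 : (1 < a)%N by apply: leq_trans a6.
have a0 := ltnW a1.
have exN : exists N, (0 < N)%N && (y <= frac_sum R a (N * a)).
  by have [N N0 yN] := frac_sum_unbounded _ _ y a1; exists N; rewrite N0.
case: (ex_minnP exN) => N /andP[N0 yN] minN.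
have endN : frac_sum R a (N.+1 * a) - (1 - a%:R^-1) <= y.
  case: N N0 yN minN => // -[_ _ _|N _ _ minN].
    exact: le_trans (first_block_end _ _ a0) hy.
  have ltN : frac_sum R a (N.+1 * a) < y.
    rewrite ltNge; apply/negP => yN.
    by have := minN N.+1; rewrite yN ltnn => /(_ isT).
  have le1 := frac_sum_block_le R a N.+1 a0.
  have le2 := frac_sum_block_le R a N.+2 a0.
  have inv_le m p : (0 < p)%N -> (p <= m)%N -> m%:R^-1 <= p%:R^-1 :> R.
    by move=> p0 pm; rewrite lef_pV2 ?posrE ?ltr0n ?ler_nat// (leq_trans p0).
  have i2 := inv_le N.+2 2%N isT isT; have i3 := inv_le N.+3 3%N isT isT.
  have i6 := inv_le a 6%N isT a6.
  move: N.+2%:R^-1 N.+3%:R^-1 a%:R^-1 le1 le2 i2 i3 i6 => /= *.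
  lra.
have [||||i ia hi] := @discrete_ivt R
    (fun r => f (N * a + r) (a%:R^-1 : R)) a%:R^-1 y a.-1.
- by rewrite invr_ge0.
- by move=> r; rewrite ltn_predRL; apply: f_inv_nat_step.
- rewrite addn0 f_inv_nat// modnMl mul0r subr0.
  by rewrite /frac_sum big_nat_recr//= modnMl !mul0r addr0.
- rewrite f_inv_nat// -addnS prednK// modnMDl modn_small ?prednK//.
  by rewrite -subn1 natrB// mulrBl mul1r divff ?pnatr_eq0 -?lt0n// addnC -mulSn.
- by exists (N * a + i)%N => //; rewrite (leq_trans (leq_pmull a N0))// leq_addr.
Qed.

Theorem corollary6 (R : realType) (n : nat) (hn : (1 <= n)%N) :
  dense_in (S_ R n) [set` `[1 - ln (2 : R), +oo[ ].
Proof.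
move=> y /=; rewrite in_itv/= andbT => hy B /nbhs_ballP[e /= e0 eB].
pose a := maxn (maxn 6 n) (Num.bound e^-1).
have a6 : (6 <= a)%N by rewrite /a -maxnA leq_maxl.
have na : (n <= a)%N by rewrite /a (maxnC 6) -maxnA leq_maxl.
have ae : a%:R^-1 < e.
  rewrite invf_plt ?posrE ?ltr0n ?(leq_trans _ a6)//.
  by rewrite (lt_le_trans (unstable.ltr_bound _))// ler_nat leq_maxr.
have [k ak /andP[yf fy]] := f_inv_nat_approx _ _ _ a6 hy.
exists (f k a%:R^-1); split; first split.
- by exists k, a%:R^-1; split => //; apply: leq_trans ak.
- by rewrite /= in_itv/= andbT (le_trans hy).
- apply: eB; rewrite /ball/= ler0_norm ?subr_le0//.
  by rewrite opprB ltrBlDl (le_lt_trans fy)// ltrD2l.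
Qed.
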